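(* Let $z=(z_{i,j})\in\mathbb{R}^{n\times m}$, $z_{i,j}=y_i\sigma(b_j+x_i^\top c_j)$, with rows $z_i\in\mathbb{R}^m$ and $\|z\|_\infty=\max_{i,j}|z_{i,j}|$, and let $$F(r)=-\log\Big(\frac1n\sum_{i=1}^n\exp\Big(-\frac1m\sum_{j=1}^m z_{i,j}r_j\Big)\Big),\qquad r\in\mathbb{R}^m.$$ Consider the gradient ascent iterates $r(t+1)=r(t)+\eta(t)\,m\nabla F(r(t))$, $t\in\mathbb{N}$. Let $a(t)=r(t)/m$, $\beta(t)=\max\{1,\max_{0\le s\le t}\sqrt m\|a(s)\|_2\}$ and $\bar a(t)=a(t)/\beta(t)$. Assume $\gamma_2^{(m)}:=\max_{\sqrt m\|a\|_2\le1}\min_{i\in[n]}z_i^\top a>0$. Then for the step-sizes $\eta(t)=\beta(t)\sqrt2/(\|z\|_\infty\sqrt{t+1})$ and initialization $r(0)=0$, it holds for all $t\ge1$ $$\max_{0\le s\le t-1}\min_{i\in[n]}z_i^\top\bar a(s)\ \ge\ \gamma_2^{(m)}-\frac{\|z\|_\infty}{\sqrt t}\Big(2\sqrt2+\frac{\sqrt3\log n}{\gamma_2^{(m)}}\Big).$$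
   Context: $(x_i,y_i)_{i\in[n]}$ is a training set with $x_i\in\mathbb{R}^d$, $y_i\in\{-1,1\}$; $\sigma:\mathbb{R}\to\mathbb{R}$ is a fixed non-linearity (e.g. $\sigma(u)=\max\{0,u\}$); $(b_j,c_j)\in\mathbb{R}\times\mathbb{R}^d$, $j\in[m]$, are fixed input-layer parameters; $[n]=\{1,\dots,n\}$. *)

(* Defs.v *)
From mathcomp Require Import all_boot all_order all_algebra.
From mathcomp Require Import all_classical all_reals all_analysis.

Set Implicit Arguments.
Unset Strict Implicit.
Unset Printing Implicit Defensive.

Import Order.TTheory GRing.Theory Num.Theory.
Import numFieldNormedType.Exports.
Local Open Scope classical_set_scope.
Local Open Scope ring_scope.

(* Vectors of R^k are row vectors.  The sample size is n.+1, so that the minimum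
   over the samples is over a nonempty set.  On matrices, the library norm `|z|
   is the entrywise maximum norm (see norm_matrixE), hence the separate norm2. *)

Definition dotr (R : realType) (k : nat) (u v : 'rV[R]_k) : R :=
  \sum_(j < k) u 0 j * v 0 j.

Definition norm2 (R : realType) (k : nat) (u : 'rV[R]_k) : R :=
  Num.sqrt (\sum_(j < k) u 0 j ^+ 2).

(* See gradP: for differentiable f this represents the differential. *)
Definition grad (R : realType) (k : nat) (f : 'rV[R]_k -> R) (r : 'rV[R]_k)
    : 'rV[R]_k :=
  \row_(j < k) 'D_(delta_mx 0 j) f r.

Definition feature_mx (R : realType) (d n m : nat) (sigma : R -> R)
    (x : 'I_n.+1 -> 'rV[R]_d) (y : 'I_n.+1 -> R)
    (b : 'I_m -> R) (c : 'I_m -> 'rV[R]_d) : 'M[R]_(n.+1, m) :=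
  \matrix_(i, j) (y i * sigma (b j + dotr (x i) (c j))).

Definition smooth_margin (R : realType) (n m : nat) (z : 'M[R]_(n.+1, m))
    (r : 'rV[R]_m) : R :=
  - ln (n.+1%:R^-1 *
        \sum_(i < n.+1) expR (- (m%:R^-1 * \sum_(j < m) z i j * r 0 j))).

(* The default value of the iterated minimum is one of its terms. *)
Definition min_margin (R : realType) (n m : nat) (z : 'M[R]_(n.+1, m))
    (a : 'rV[R]_m) : R :=
  \big[Num.min/dotr (row ord0 z) a]_(i < n.+1) dotr (row i z) a.

(* The supremum is a maximum: see gamma2_max. *)
Definition gamma2 (R : realType) (n m : nat) (z : 'M[R]_(n.+1, m)) : R :=
  sup [set min_margin z a | a in [set a | Num.sqrt m%:R * norm2 a <= 1]].

Definition avg (R : realType) (m : nat) (r : nat -> 'rV[R]_m) (t : nat)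
    : 'rV[R]_m :=
  m%:R^-1 *: r t.

Definition beta (R : realType) (m : nat) (r : nat -> 'rV[R]_m) (t : nat) : R :=
  \big[Num.max/1]_(s < t.+1) (Num.sqrt m%:R * norm2 (avg r s)).

Definition avg_normalized (R : realType) (m : nat) (r : nat -> 'rV[R]_m)
    (t : nat) : 'rV[R]_m :=
  (beta r t)^-1 *: avg r t.

Definition step_size (R : realType) (n m : nat) (z : 'M[R]_(n.+1, m))
    (r : nat -> 'rV[R]_m) (t : nat) : R :=
  beta r t * Num.sqrt 2 / (`|z| * Num.sqrt t.+1%:R).

Lemma norm_matrixE (R : realType) (n m : nat) (z : 'M[R]_(n, m)) :
  `|z| = \big[Num.max/0]_(ij : 'I_n * 'I_m) `|z ij.1 ij.2|.
Proof. by rewrite /Num.norm /= mx_normrE. Qed.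

Lemma gradP (R : realType) (k : nat) (f : 'rV[R]_k -> R) (r v : 'rV[R]_k) :
  differentiable f r -> 'd f r v = dotr (grad f r) v.
Proof.
move=> df; rewrite {1}[v]row_sum_delta linear_sum; apply: eq_bigr => j _.
by rewrite linearZ /= mxE deriveE// mulrC.
Qed.

Lemma continuous_sumr (R : realType) (T : topologicalType) (k : nat)
    (F : 'I_k -> T -> R) :
  (forall j, continuous (F j)) -> continuous (fun a => \sum_(j < k) F j a).
Proof.
move=> cF; have cadd : continuous (fun u : R * R => u.1 + u.2).
  exact: add_continuous.
by have := @continuous_big R 'I_k +%R 0 xpredT cadd T (index_enum _) F; apply.
Qed.

Lemma continuous_dotr (R : realType) (k : nat) (u : 'rV[R]_k) :
  continuous (dotr u).
Proof.
have := @continuous_sumr R _ k (fun j (v : 'rV[R]_k) => u 0 j * v 0 j).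
apply=> j a; apply: (@continuousM _ _ (cst (u 0 j)) (fun v : 'rV[R]_k => v 0 j)).
  exact: cst_continuous.
exact: coord_continuous.
Qed.

Lemma continuous_norm2 (R : realType) (k : nat) : continuous (@norm2 R k).
Proof.
have cs : continuous (fun a : 'rV[R]_k => \sum_(j < k) a 0 j ^+ 2).
  have := @continuous_sumr R _ k (fun j (v : 'rV[R]_k) => v 0 j ^+ 2).
  apply=> j a; under eq_fun do rewrite expr2.
  apply: (@continuousM _ _ (fun v : 'rV[R]_k => v 0 j) (fun v => v 0 j));
    exact: coord_continuous.
by move=> a; apply: continuous_comp; [exact: cs|exact: sqrt_continuous].
Qed.

Lemma continuous_min_margin (R : realType) (n m : nat) (z : 'M[R]_(n.+1, m)) :
  continuous (min_margin z).
Proof.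
rewrite /min_margin; elim: (index_enum _) => [|i s IH] a.
  under eq_fun do rewrite big_nil.
  exact: continuous_dotr.
under eq_fun do rewrite big_cons.
by apply: continuous_min; [exact: continuous_dotr|exact: IH].
Qed.

Lemma compact_ball2 (R : realType) (m : nat) :
  compact [set a : 'rV[R]_m | Num.sqrt m%:R * norm2 a <= 1].
Proof.
apply: bounded_closed_compact.
  exists 1; split=> // M M1 a /= a1; rewrite norm_matrixE.
  apply: bigmax_le => [|[i j] _ /=]; first by rewrite (le_trans _ (ltW M1)).
  apply: le_trans (ltW M1); apply: le_trans a1; rewrite (ord1 i).
  have m1 : 1 <= m%:R :> R by rewrite ler1n; exact: leq_trans (ltn_ord j).
  have sm1 : 1 <= Num.sqrt m%:R :> R by have := ler_wsqrtr m1; rewrite sqrtr1.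
  rewrite -[leLHS]mul1r; apply: ler_pM => //.
  rewrite -sqrtr_sqr ler_wsqrtr// (bigD1 j)//= lerDl.
  by apply: sumr_ge0 => l _; exact: sqr_ge0.
apply: (@preimage_closed _ _ (fun a => Num.sqrt m%:R * norm2 a)
  [set x : R | x <= 1]); last exact: closed_le.
by move=> a _; apply: (@continuousM _ _ (cst (Num.sqrt m%:R)) (@norm2 R m));
  [exact: cst_continuous|exact: continuous_norm2].
Qed.

Lemma gamma2_max (R : realType) (n m : nat) (z : 'M[R]_(n.+1, m)) :
  exists2 a, Num.sqrt m%:R * norm2 a <= 1 &
    gamma2 z = min_margin z a /\
    forall a', Num.sqrt m%:R * norm2 a' <= 1 -> min_margin z a' <= min_margin z a.
Proof.
pose B := [set a : 'rV[R]_m | Num.sqrt m%:R * norm2 a <= 1].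
have B0 : B 0.
  rewrite /B /= /norm2 big1 ?sqrtr0 ?mulr0 ?ler01// => j _.
  by rewrite mxE expr0n.
have [||a] := @compact_EVT_max _ R (min_margin z) B _ (@compact_ball2 R m).
- by exists 0.
- by apply: continuous_subspaceT; exact: continuous_min_margin.
rewrite inE => Ba amax.
have {}amax a' : B a' -> min_margin z a' <= min_margin z a.
  by move=> Ba'; apply: amax; rewrite inE.
exists a => //; split=> //; apply/le_anti/andP; split.
  apply: ge_sup; first by exists (min_margin z 0), 0.
  by move=> _ [a' Ba' <-]; exact: amax.
apply: ub_le_sup; last by exists a.
by exists (min_margin z a) => _ [a' Ba' <-]; exact: amax.
Qed.

(* Main.v *)
Require Import Defs.
From mathcomp Require Import all_boot all_order all_algebra.
From mathcomp Require Import all_classical all_reals all_analysis.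
From mathcomp Require Import ring lra.

Set Implicit Arguments.
Unset Strict Implicit.
Unset Printing Implicit Defensive.

Import Order.TTheory GRing.Theory Num.Theory.
Import numFieldNormedType.Exports.
Local Open Scope ring_scope.

(* Normalizing by the running maximum [beta] turns the gradient ascent into
   projected (sub)gradient ascent on the ball [sqrt m * |a| <= 1] with step-sizes
   [alpha t = sqrt 2 / (|z| sqrt (t+1))].  The gradient direction
   [g = \sum_i p_i z_i] has softmin weights [p] at the unnormalized iterate, so by
   Gibbs' inequality [g . abar <= min_i z_i . abar + ln n / beta], whereas
   [g . v >= gamma2] for an optimal direction [v].  Hence the margin deficit at
   step [s] is at most [g_s . (v - abar_s) + ln n / beta_s].  The first terms add
   up to at most [2 sqrt 2 |z| sqrt t], the regret of projected ascent.  For the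
   second ones, [m * (a_t . v)] grows by at least [alpha t * gamma2] at each step,
   so [beta_t >= sqrt 2 (gamma2 / |z|) sqrt t], which together with [beta_t >= 1]
   gives [\sum_(s < t) 1 / beta_s <= sqrt 3 |z| sqrt t / gamma2]. *)

(** * Euclidean geometry of row vectors *)

Lemma dotrC (R : realType) (k : nat) (u v : 'rV[R]_k) : dotr u v = dotr v u.
Proof. by apply: eq_bigr => j _; rewrite mulrC. Qed.

Lemma dotrDr (R : realType) (k : nat) (u v w : 'rV[R]_k) :
  dotr u (v + w) = dotr u v + dotr u w.
Proof. by rewrite -big_split; apply: eq_bigr => j _; rewrite mxE mulrDr. Qed.

Lemma dotrZr (R : realType) (k : nat) (a : R) (u v : 'rV[R]_k) :
  dotr u (a *: v) = a * dotr u v.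
Proof. by rewrite mulr_sumr; apply: eq_bigr => j _; rewrite mxE mulrCA. Qed.

Lemma dotrBr (R : realType) (k : nat) (u v w : 'rV[R]_k) :
  dotr u (v - w) = dotr u v - dotr u w.
Proof. by rewrite -scaleN1r dotrDr dotrZr mulN1r. Qed.

Lemma dotrDl (R : realType) (k : nat) (u v w : 'rV[R]_k) :
  dotr (v + w) u = dotr v u + dotr w u.
Proof. by rewrite dotrC dotrDr !(dotrC u). Qed.

Lemma dotrZl (R : realType) (k : nat) (a : R) (u v : 'rV[R]_k) :
  dotr (a *: u) v = a * dotr u v.
Proof. by rewrite dotrC dotrZr dotrC. Qed.

Lemma dotrBl (R : realType) (k : nat) (u v w : 'rV[R]_k) :
  dotr (v - w) u = dotr v u - dotr w u.
Proof. by rewrite dotrC dotrBr !(dotrC u). Qed.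

Lemma dotr_suml (R : realType) (k n : nat) (F : 'I_n -> 'rV[R]_k)
    (u : 'rV[R]_k) :
  dotr (\sum_i F i) u = \sum_i dotr (F i) u.
Proof.
rewrite exchange_big; apply: eq_bigr => j _ /=.
by rewrite summxE mulr_suml.
Qed.

Lemma dotr_ge0 (R : realType) (k : nat) (u : 'rV[R]_k) : 0 <= dotr u u.
Proof. by apply: sumr_ge0 => j _; rewrite -expr2 sqr_ge0. Qed.

Lemma norm2_ge0 (R : realType) (k : nat) (u : 'rV[R]_k) : 0 <= norm2 u.
Proof. exact: sqrtr_ge0. Qed.

Lemma norm2_sqr (R : realType) (k : nat) (u : 'rV[R]_k) :
  norm2 u ^+ 2 = dotr u u.
Proof.
rewrite sqr_sqrtr; last by apply: sumr_ge0 => j _; exact: sqr_ge0.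
by apply: eq_bigr => j _; rewrite expr2.
Qed.

Lemma norm2Z (R : realType) (k : nat) (a : R) (u : 'rV[R]_k) :
  0 <= a -> norm2 (a *: u) = a * norm2 u.
Proof.
move=> a0; apply/eqP.
rewrite -(eqrXn2 (n := 2)) ?mulr_ge0 ?norm2_ge0//.
by rewrite exprMn !norm2_sqr dotrZl dotrZr mulrA -expr2.
Qed.

(** The later estimates use this form of the ball, which is free of square roots. *)
Lemma dotr_ball (R : realType) (k : nat) (c : R) (u : 'rV[R]_k) :
  0 <= c -> Num.sqrt c * norm2 u <= 1 -> c * dotr u u <= 1.
Proof.
move=> c0 u1.
rewrite -norm2_sqr -[c]sqr_sqrtr// -exprMn expr_le1// mulr_ge0 ?sqrtr_ge0//.
Qed.

(** Expanding [0 <= c * dotr (u - v) (u - v)] takes the place of Cauchy-Schwarz. *)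
Lemma dotr_le1 (R : realType) (k : nat) (c : R) (u v : 'rV[R]_k) :
  0 <= c -> c * dotr u u <= 1 -> c * dotr v v <= 1 -> c * dotr u v <= 1.
Proof.
move=> c0 u1 v1; have := mulr_ge0 c0 (dotr_ge0 (u - v)).
rewrite dotrBr !dotrBl (dotrC v u); lra.
Qed.

Lemma dist_ball_le4 (R : realType) (k : nat) (c : R) (u v : 'rV[R]_k) :
  0 <= c -> c * dotr u u <= 1 -> c * dotr v v <= 1 ->
  c * dotr (u - v) (u - v) <= 4.
Proof.
move=> c0 u1 v1; have := mulr_ge0 c0 (dotr_ge0 (u + v)).
rewrite dotrBr !dotrBl dotrDr !dotrDl (dotrC v u); lra.
Qed.

(* [u / max 1 |u|] is the metric projection of [u] onto the unit ball. *)
Lemma dist_proj_ball (R : realType) (k : nat) (c : R) (u v : 'rV[R]_k) :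
  0 <= c -> c * dotr v v <= 1 ->
  let p := (Num.max 1 (Num.sqrt c * norm2 u))^-1 *: u in
  c * dotr (p - v) (p - v) <= c * dotr (u - v) (u - v).
Proof.
move=> c0 v1 /=; set N := Num.sqrt c * norm2 u.
have NE : N ^+ 2 = c * dotr u u by rewrite exprMn sqr_sqrtr// norm2_sqr.
case: (leP N 1) => [N1|N1]; first by rewrite invr1 scale1r.
have N0 : N != 0 by rewrite gt_eqF// (lt_trans _ N1).
set p := N^-1 *: u; have up : u = N *: p by rewrite scalerA divff// scale1r.
have pp : c * dotr p p = 1.
  by rewrite dotrZl dotrZr !(mulrCA c) -NE; field.
have pv : c * dotr p v <= 1 by apply: dotr_le1 => //; rewrite pp.
clearbody p.
rewrite [in leRHS]up !dotrBr !dotrBl !dotrZr !dotrZl (dotrC v p).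
rewrite -subr_ge0.
set X := dotr p p in pp *; set Y := dotr p v in pv *; set W := dotr v v in v1 *.
(* As [c * X = 1] and [c * Y <= 1], this is at least [(N ^+ 2 - 1) - 2 * (N - 1) = (N - 1) ^+ 2]. *)
have -> : c * (N * (N * X) - N * Y - (N * Y - W)) - c * (X - Y - (Y - W)) =
  (N ^+ 2 - 1) * (c * X) - 2 * (N - 1) * (c * Y) by ring.
rewrite pp; nra.
Qed.

(** * Margins, softmin weights and the ascent direction *)

Lemma entry_le_norm (R : realType) (n m : nat) (z : 'M[R]_(n, m)) i j :
  `|z i j| <= `|z|.
Proof.
rewrite norm_matrixE.
exact: (le_bigmax _ (fun ij : 'I_n * 'I_m => `|z ij.1 ij.2|) (i, j)).
Qed.

Lemma min_margin_le (R : realType) (n m : nat) (z : 'M[R]_(n.+1, m)) a i :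
  min_margin z a <= dotr (row i z) a.
Proof. exact: bigmin_le_cond. Qed.

Lemma min_margin_attained (R : realType) (n m : nat) (z : 'M[R]_(n.+1, m)) a :
  exists i, min_margin z a = dotr (row i z) a.
Proof.
rewrite /min_margin.
by elim/big_ind: _ => [|u v [i ->] [j ->]|i _];
  [exists ord0 | case: leP => _; [exists i|exists j] | exists i].
Qed.

Definition softmin (R : realType) (n : nat) (u : 'I_n.+1 -> R)
    (i : 'I_n.+1) : R :=
  expR (- u i) / \sum_k expR (- u k).

Lemma sum_expR_gt0 (R : realType) (n : nat) (u : 'I_n.+1 -> R) :
  0 < \sum_k expR (u k).
Proof.
rewrite (bigD1 ord0)//= ltr_pwDl ?expR_gt0//.
by apply: sumr_ge0 => k _; exact: expR_ge0.
Qed.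

Lemma softmin_ge0 (R : realType) (n : nat) (u : 'I_n.+1 -> R) i :
  0 <= softmin u i.
Proof.
by rewrite divr_ge0 ?expR_ge0// ltW// (sum_expR_gt0 (fun k => - u k)).
Qed.

Lemma sum_softmin (R : realType) (n : nat) (u : 'I_n.+1 -> R) :
  \sum_i softmin u i = 1.
Proof.
by rewrite -mulr_suml divff// gt_eqF// (sum_expR_gt0 (fun k => - u k)).
Qed.

(* Gibbs' inequality: the entropy of the weights is at most [ln n.+1]. *)
Lemma softmin_mean_le (R : realType) (n : nat) (u : 'I_n.+1 -> R) k :
  \sum_i softmin u i * u i <= u k + ln n.+1%:R.
Proof.
set W := \sum_k expR (- u k).
have W0 : 0 < W by exact: (sum_expR_gt0 (fun k => - u k)).
have n0 : (0 : R) < n.+1%:R by rewrite ltr0n.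
have kW : - u k <= ln W.
  rewrite -[- u k]expRK ler_ln ?posrE ?expR_gt0// /W (bigD1 k)//= lerDl.
  by apply: sumr_ge0 => i _; exact: expR_ge0.
(* This is [1 + x <= expR x] at [x = u i + ln W - ln n.+1%:R], where [expR x] is the uniform weight
   divided by [softmin u i]. In the sum over [i] the contributions of -1 and [n.+1%:R^-1] cancel. *)
have term i : softmin u i * u i <=
    softmin u i * (ln n.+1%:R - ln W - 1) + n.+1%:R^-1.
  have := expR_ge1Dx (u i + ln W - ln n.+1%:R).
  rewrite expRD expRN lnK ?posrE// expRD lnK ?posrE// => h.
  have := ler_wpM2l (softmin_ge0 u i) h.
  have -> : softmin u i * (expR (u i) * W / n.+1%:R) = n.+1%:R^-1.
    rewrite /softmin -/W expRN; field.
    by rewrite nat1r !gt_eqF ?expR_gt0.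
  by move: (n.+1%:R^-1) => N; lra.
apply: le_trans (ler_sum _ (fun i _ => term i)) _.
rewrite big_split /= -mulr_suml sum_softmin sumr_const card_ord.
rewrite -[_^-1 *+ _]mulr_natl divff ?gt_eqF//; lra.
Qed.

(** At [a = r / m] this is [m] times the gradient of the smooth margin at [r]; see
    [grad_smooth_margin]. *)
Definition softmin_row (R : realType) (n m : nat) (z : 'M[R]_(n.+1, m))
    (a : 'rV[R]_m) : 'rV[R]_m :=
  \sum_i softmin (fun k => dotr (row k z) a) i *: row i z.

Lemma dotr_softmin_row (R : realType) (n m : nat) (z : 'M[R]_(n.+1, m)) a v :
  dotr (softmin_row z a) v =
  \sum_i softmin (fun k => dotr (row k z) a) i * dotr (row i z) v.
Proof. by rewrite dotr_suml; apply: eq_bigr => i _; rewrite dotrZl. Qed.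

Lemma dotr_softmin_row_ge (R : realType) (n m : nat) (z : 'M[R]_(n.+1, m)) a v :
  min_margin z v <= dotr (softmin_row z a) v.
Proof.
rewrite dotr_softmin_row -[leLHS]mul1r.
rewrite -(sum_softmin (fun k => dotr (row k z) a)) mulr_suml.
by apply: ler_sum => i _; apply: ler_wpM2l;
  [exact: softmin_ge0|exact: min_margin_le].
Qed.

Lemma dotr_softmin_row_le (R : realType) (n m : nat) (z : 'M[R]_(n.+1, m)) a :
  dotr (softmin_row z a) a <= min_margin z a + ln n.+1%:R.
Proof.
have [k ->] := min_margin_attained z a.
rewrite dotr_softmin_row.
exact: (softmin_mean_le (fun k => dotr (row k z) a)).
Qed.

(** Each entry is a convex combination of a column of [z]. *)
Lemma softmin_row_bound (R : realType) (n m : nat) (z : 'M[R]_(n.+1, m)) a :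
  dotr (softmin_row z a) (softmin_row z a) <= m%:R * `|z| ^+ 2.
Proof.
rewrite -[X in X%:R](card_ord m) mulr_natl -sumr_const.
apply: ler_sum => j _; rewrite -expr2 -real_normK ?num_real//.
rewrite lerXn2r ?nnegrE// summxE; apply: le_trans (ler_norm_sum _ _ _) _.
rewrite -[leRHS]mul1r -(sum_softmin (fun k => dotr (row k z) a)) mulr_suml.
apply: ler_sum => i _; rewrite !mxE normrM ger0_norm ?softmin_ge0//.
by apply: ler_wpM2l; [exact: softmin_ge0|exact: entry_le_norm].
Qed.

(** * The gradient of the smooth margin *)

Lemma derive_line (R : realType) (V : normedModType R) (f : V -> R) (a v : V) :
  'D_v f a = 'D_1 (fun h : R => f (a + h *: v)) 0.
Proof.
rewrite /derive; set q := (X in (X @ _)%classic).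
set q' := (X in _ = lim (X @ _)%classic).
suff -> : q = q' by [].
apply/funext => h; rewrite /q /q' /=.
by rewrite scale0r !addr0 /GRing.scale /= mulr1 (addrC a).
Qed.

(** Along a line the exponents of the smooth margin are affine in [h]; the factor [c] cancels in the
    logarithmic derivative. *)
Lemma is_derive_ln_mean_expR (R : realType) (n : nat) (c : R)
    (A B : 'I_n.+1 -> R) :
  0 < c ->
  is_derive (0 : R) (1 : R)
    (fun h : R => - ln (c * \sum_i expR (A i + h * B i)))
    (- ((\sum_i expR (A i) * B i) / \sum_i expR (A i))).
Proof.
move=> c0; set W := \sum_i expR (A i).
have W0 : 0 < W by exact: sum_expR_gt0.
have dexp i : is_derive (0 : R) (1 : R) (fun h : R => expR (A i + h * B i))
    (expR (A i) * B i).
  have d1 : is_derive (0 : R) (1 : R) (fun h : R => A i + h * B i) (B i).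
    have did := @is_derive_id R R 0 1.
    have dB := is_deriveM did (@is_derive_cst R R R (B i) 0 1).
    apply: (is_derive_eq (is_deriveD (@is_derive_cst R R R (A i) 0 1) dB)).
    by rewrite scaler0 !add0r /GRing.scale /= mulr1.
  have := @is_derive1_comp R expR (fun h => A i + h * B i)
    _ _ _ (is_derive_expR _) d1.
  by rewrite mul0r addr0.
have dsum : is_derive (0 : R) (1 : R)
    (fun h : R => c * \sum_i expR (A i + h * B i))
    (c * \sum_i expR (A i) * B i).
  have -> : (fun h : R => c * \sum_i expR (A i + h * B i)) =
      c \*: (\sum_i (fun h : R => expR (A i + h * B i))).
    by apply/funext => h /=; rewrite fct_sumE.
  exact: is_deriveZ.
have E0 : c * (\sum_i expR (A i + 0 * B i)) = c * W.
  by congr (_ * _); apply: eq_bigr => i _; rewrite mul0r addr0.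
have dln : is_derive (c * \sum_i expR (A i + 0 * B i)) (1 : R)
    (@ln R) (c * W)^-1.
  by rewrite E0; apply: is_derive1_ln; rewrite mulr_gt0.
have dc := @is_derive1_comp R (@ln R) (fun h => c * \sum_i expR (A i + h * B i))
  _ _ _ dln dsum.
apply: (is_derive_eq (is_deriveN dc)).
by congr (- _); field; rewrite !gt_eqF.
Qed.

Lemma grad_smooth_margin (R : realType) (n m : nat) (z : 'M[R]_(n.+1, m)) r :
  m%:R *: grad (smooth_margin z) r = softmin_row z (m%:R^-1 *: r).
Proof.
apply/rowP => j; have m0 : m%:R != 0 :> R.
  by rewrite pnatr_eq0 -lt0n (leq_trans _ (ltn_ord j)).
rewrite !mxE derive_line.
(* Value and slope of the [i]-th exponent on the [j]-th coordinate line through [r]. *)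
pose A i := - dotr (row i z) (m%:R^-1 *: r).
pose B i := - (m%:R^-1 * z i j).
have -> : (fun h : R => smooth_margin z (r + h *: delta_mx 0 j)) =
    fun h : R => - ln (n.+1%:R^-1 * \sum_i expR (A i + h * B i)).
  apply/funext => h; rewrite /smooth_margin; congr (- ln (_ * _)).
  apply: eq_bigr => i _; congr expR.
  have -> : \sum_k z i k * (r + h *: delta_mx 0 j) 0 k =
      dotr (row i z) (r + h *: delta_mx 0 j).
    by apply: eq_bigr => k _; rewrite [row _ _ _ _]mxE.
  rewrite dotrDr dotrZr /A /B dotrZr.
  have -> : dotr (row i z) (delta_mx 0 j) = z i j.
    rewrite /dotr (bigD1 j)//= big1 ?addr0 => [|k kj].
      by rewrite !mxE !eqxx mulr1.
    by rewrite !mxE (negPf kj) andbF mulr0.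
  ring.
have n0 : 0 < n.+1%:R^-1 :> R by rewrite invr_gt0 ltr0n.
have dl := is_derive_ln_mean_expR A B n0.
rewrite derive_val summxE.
rewrite mulrN mulr_suml mulr_sumr -sumrN; apply: eq_bigr => i _.
have W0 : \sum_k expR (A k) != 0 by rewrite gt_eqF// sum_expR_gt0.
by rewrite !mxE /softmin -/(A i) /B; field; rewrite W0.
Qed.

(** * Sums of inverse square roots *)

(** With [T] and [S] the two roots, [(T - S) * (T + S) = 1] and [S <= T]. Telescoping this bounds
    sums of inverse roots. *)
Lemma sqrt_succB_ge (R : realType) (t : nat) :
  (2 * Num.sqrt t.+1%:R)^-1 <= Num.sqrt t.+1%:R - Num.sqrt t%:R :> R.
Proof.
have S0 : 0 <= Num.sqrt (t%:R : R) by exact: sqrtr_ge0.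
have T0 : 0 < Num.sqrt (t.+1%:R : R) by rewrite sqrtr_gt0 ltr0n.
have TS : Num.sqrt (t.+1%:R : R) ^+ 2 = Num.sqrt (t%:R : R) ^+ 2 + 1.
  by rewrite !sqr_sqrtr ?ler0n// -natr1.
move: (Num.sqrt t%:R) (Num.sqrt t.+1%:R) S0 T0 TS => S T S0 T0 TS.
by rewrite -div1r ler_pdivrMr; [nra | lra].
Qed.

Lemma sum_inv_le_sqrt (R : realType) (q : R) (f : nat -> R) (t : nat) :
  0 < q <= 1 -> (forall s, 1 <= f s) ->
  (forall s, Num.sqrt 2 * q * Num.sqrt s%:R <= f s) ->
  \sum_(s < t) (f s)^-1 <= Num.sqrt 3 * Num.sqrt t%:R / q.
Proof.
move=> /andP[q0 q1] f1 fq.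
have c0 : 0 < Num.sqrt (2 : R) by rewrite sqrtr_gt0.
have c2 : Num.sqrt (2 : R) ^+ 2 = 2 by rewrite sqr_sqrtr.
case: t => [|t]; first by rewrite big_ord0 sqrtr0 mulr0 mul0r.
(* Here [t] is one less than the number of terms. The term at 0, where the growth bound is void, is
   at most [1 <= 1 / q]; the others telescope. *)
apply: (@le_trans _ _ ((1 + Num.sqrt 2 * Num.sqrt t%:R) / q)).
  elim: t => [|t IH].
    rewrite big_ord1 sqrtr0 mulr0 addr0 div1r lef_pV2 ?posrE//.
      exact: le_trans q1 (f1 _).
    exact: lt_le_trans (f1 _).
  rewrite big_ord_recr /=.
  have T0 : 0 < Num.sqrt (t.+1%:R : R) by rewrite sqrtr_gt0 ltr0n.
  have h : (f t.+1)^-1 <= Num.sqrt 2 * (2 * Num.sqrt t.+1%:R)^-1 / q.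
    have -> : Num.sqrt 2 * (2 * Num.sqrt t.+1%:R)^-1 / q =
        (Num.sqrt 2 * q * Num.sqrt t.+1%:R)^-1.
      by rewrite -{2}c2; field; rewrite !gt_eqF.
    by rewrite lef_pV2 ?posrE ?mulr_gt0//; exact: lt_le_trans (f1 _).
  apply: le_trans (lerD IH h) _.
  rewrite -mulrDl ler_pM2r ?invr_gt0//.
  have := ler_wpM2l (ltW c0) (sqrt_succB_ge R t); lra.
rewrite ler_pM2r ?invr_gt0//.
rewrite -ler_sqr ?nnegrE ?mulr_ge0 ?addr_ge0 ?mulr_ge0 ?sqrtr_ge0//.
rewrite exprMn !sqr_sqrtr// -natr1.
(* The constant [sqrt 3] comes from [3 * (t + 1) - (1 + sqrt 2 * sqrt t) ^+ 2 = (sqrt t - sqrt 2) ^+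
   2]. *)
have := sqr_ge0 (Num.sqrt t%:R - Num.sqrt 2 : R).
have : Num.sqrt (t%:R : R) ^+ 2 = t%:R by rewrite sqr_sqrtr.
move: (Num.sqrt t%:R) (Num.sqrt 2) c2 => S c c2; nra.
Qed.

(** * The running maximum and the normalized iterates *)

Section beta.
Context (R : realType) (m : nat) (r : nat -> 'rV[R]_m).

Lemma beta_ge1 t : 1 <= beta r t.
Proof. exact: bigmax_ge_id. Qed.

Lemma beta_gt0 t : 0 < beta r t.
Proof. exact: lt_le_trans (beta_ge1 t). Qed.

Lemma beta_ge t : Num.sqrt m%:R * norm2 (avg r t) <= beta r t.
Proof.
exact: (le_bigmax _ (fun s : 'I_t.+1 => Num.sqrt m%:R * norm2 (avg r s))
  ord_max).
Qed.

Lemma betaS t :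
  beta r t.+1 = Num.max (beta r t) (Num.sqrt m%:R * norm2 (avg r t.+1)).
Proof.
apply/le_anti/andP; split.
  apply: bigmax_le => [|s _]; first by rewrite le_max beta_ge1.
  rewrite le_max; have := ltn_ord s; rewrite ltnS leq_eqVlt => /predU1P[->|st].
    by rewrite lexx orbT.
  by rewrite (le_bigmax _ (fun s : 'I_t.+1 => Num.sqrt m%:R * norm2 (avg r s))
    (Ordinal st)).
rewrite ge_max beta_ge andbT; apply: bigmax_le => [|s _]; first exact: beta_ge1.
exact: (le_bigmax _ (fun s : 'I_t.+2 => Num.sqrt m%:R * norm2 (avg r s))
  (widen_ord (leqnSn _) s)).
Qed.

Lemma avgE t : avg r t = beta r t *: avg_normalized r t.
Proof. by rewrite scalerA divff ?scale1r// gt_eqF// beta_gt0. Qed.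

Lemma avg_normalized_ball t :
  m%:R * dotr (avg_normalized r t) (avg_normalized r t) <= 1.
Proof.
apply: dotr_ball => //; rewrite norm2Z; last by rewrite invr_ge0 ltW ?beta_gt0.
by rewrite mulrCA ler_pdivrMl ?beta_gt0// mulr1 beta_ge.
Qed.

End beta.

(** * Regret of projected ascent and the margin bound *)

Section ascent.
Context (R : realType) (n m : nat) (z : 'M[R]_(n.+1, m)) (r : nat -> 'rV[R]_m).
Context (gamma_gt0 : 0 < gamma2 z) (r0 : r 0%N = 0).
Context (rS : forall t : nat,
  r t.+1 = r t + (step_size z r t * m%:R) *: grad (smooth_margin z) (r t)).

Let Z := `|z|.
Let alpha t : R := Num.sqrt 2 / (Z * Num.sqrt t.+1%:R).
Let g t := softmin_row z (avg r t).
(** Squared distance, scaled so that the constraint set is the unit ball. *)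
Let dist (v : 'rV[R]_m) s : R :=
  m%:R * dotr (avg_normalized r s - v) (avg_normalized r s - v).

Lemma features_gt0 : (0 < m)%N.
Proof.
case: m z gamma_gt0 => // z0; have [a _ [-> _]] := gamma2_max z0.
have [i ->] := min_margin_attained z0 a.
by rewrite /dotr big_ord0 ltxx.
Qed.

Lemma norm_features_gt0 : 0 < Z.
Proof.
rewrite normr_gt0; apply: contraTneq gamma_gt0 => z0.
have [a _ [-> _]] := gamma2_max z; have [i ->] := min_margin_attained z a.
by rewrite z0 /dotr big1 ?ltxx// => j _; rewrite !mxE mul0r.
Qed.

(** Provides [q <= 1] in [sum_inv_le_sqrt], for [q = gamma2 z / Z]. *)
Lemma gamma2_le_norm : gamma2 z <= Z.
Proof.
have m0 : 0 < m%:R :> R by rewrite ltr0n features_gt0.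
have [v v1 [-> _]] := gamma2_max z; have {}v1 := dotr_ball (ltW m0) v1.
apply: le_trans (dotr_softmin_row_ge z 0 v) _.
have b := ler_wpM2l (ltW m0) (softmin_row_bound z 0); move: b; rewrite -/Z.
set w := softmin_row z 0 => b.
(* Cauchy-Schwarz by a square: [w] has norm at most [sqrt m * Z], and the factor [m * Z] gives [v]
   the same bound. *)
have := mulr_ge0 (ltW m0) (dotr_ge0 (w - (m%:R * Z) *: v)).
rewrite dotrBr !dotrBl !dotrZl !dotrZr (dotrC v w) => h.
have {}v1 := ler_wpM2l (sqr_ge0 (m%:R * Z)) v1.
have mZ : 0 < 2 * m%:R ^+ 2 * Z.
  by rewrite !mulr_gt0 ?exprn_gt0 ?norm_features_gt0.
rewrite -(ler_pM2l mZ); lra.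
Qed.

Lemma alpha_gt0 t : 0 < alpha t.
Proof. by rewrite divr_gt0 ?mulr_gt0 ?norm_features_gt0 ?sqrtr_gt0 ?ltr0n. Qed.

Lemma avgS t : avg r t.+1 = avg r t + (beta r t * alpha t / m%:R) *: g t.
Proof.
have m0 : m%:R != 0 :> R by rewrite pnatr_eq0 -lt0n features_gt0.
rewrite /avg rS scalerDr /g -grad_smooth_margin !scalerA; congr (_ + _ *: _).
rewrite /step_size /alpha -/Z; field; rewrite m0 !gt_eqF ?sqrtr_gt0 ?ltr0n//.
exact: norm_features_gt0.
Qed.

(* As [beta] absorbs the growth of the iterates, the normalized iterates perform
   exactly projected gradient ascent on the ball, with step-size [alpha]. *)
Lemma avg_normalizedS t :
  let u := avg_normalized r t + (alpha t / m%:R) *: g t in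
  avg_normalized r t.+1 = (Num.max 1 (Num.sqrt m%:R * norm2 u))^-1 *: u.
Proof.
move=> u; have b0 := beta_gt0 r t.
have uE : avg r t.+1 = beta r t *: u.
  by rewrite avgS scalerDr -avgE scalerA mulrA.
rewrite {1}/avg_normalized betaS uE norm2Z ?ltW// scalerA; congr (_ *: _).
rewrite mulrCA -[X in Num.max X _]mulr1 -maxr_pMr ?ltW//.
by rewrite invfM mulrAC mulVf ?mul1r// gt_eqF.
Qed.

(** Projecting does not increase the distance to [v], so [dist v t.+1] is at most the expanded
    square before projection, whose quadratic term [softmin_row_bound] controls. *)
Lemma regret_step v t : m%:R * dotr v v <= 1 ->
  2 * alpha t * dotr (g t) (v - avg_normalized r t) <=
  dist v t - dist v t.+1 + alpha t ^+ 2 * Z ^+ 2.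
Proof.
move=> v1; have m0 : 0 < m%:R :> R by rewrite ltr0n features_gt0.
have := dist_proj_ball (avg_normalized r t + (alpha t / m%:R) *: g t)
  (ltW m0) v1.
rewrite /= -avg_normalizedS -/(dist v t.+1) addrAC.
set e := avg_normalized r t - v.
have -> : v - avg_normalized r t = -1 *: e by rewrite scaleN1r opprB.
rewrite dotrZr; set D := dist v t.+1; rewrite /dist -/e; clearbody e D.
rewrite dotrDr !dotrDl !dotrZr !dotrZl (dotrC e) => h.
have := ler_wpM2l (sqr_ge0 (alpha t)) (softmin_row_bound z (avg r t)).
rewrite -/(g t) -/Z => b.
have {}b : alpha t ^+ 2 * dotr (g t) (g t) / m%:R <= alpha t ^+ 2 * Z ^+ 2.
  by rewrite ler_pdivrMr//; lra.
apply: le_trans (lerD (lexx _) b).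
rewrite -subr_ge0; rewrite -subr_ge0 in h.
apply: le_trans h _; rewrite le_eqVlt; apply/orP; left; apply/eqP; field.
by rewrite gt_eqF.
Qed.

(** Half of the bound comes from the squared diameter 4 of the ball, half from the squared step
    lengths. *)
Lemma regret_sum v t : m%:R * dotr v v <= 1 ->
  \sum_(s < t) dotr (g s) (v - avg_normalized r s) <=
  2 * Num.sqrt 2 * Z * Num.sqrt t%:R.
Proof.
move=> v1; have dist_ge0 s : 0 <= dist v s by rewrite mulr_ge0// dotr_ge0.
have dist_le4 s : dist v s <= 4 by rewrite dist_ball_le4// avg_normalized_ball.
have c0 : 0 < Num.sqrt (2 : R) by rewrite sqrtr_gt0.
have c2 : Num.sqrt (2 : R) ^+ 2 = 2 by rewrite sqr_sqrtr.
have Z0 := norm_features_gt0.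
pose k s : R := Z * Num.sqrt s%:R / (2 * Num.sqrt 2).
have k_ge0 s : 0 <= k s by rewrite divr_ge0 ?mulr_ge0 ?sqrtr_ge0// ltW.
(* Abel summation: [k s.+1 = (2 * alpha s)^-1] is nondecreasing in [s]. *)
suff H : \sum_(s < t) dotr (g s) (v - avg_normalized r s) + k t * dist v t <=
    4 * k t + Num.sqrt 2 * Z * Num.sqrt t%:R.
  have -> : 2 * Num.sqrt 2 * Z * Num.sqrt t%:R =
      4 * k t + Num.sqrt 2 * Z * Num.sqrt t%:R.
    have -> : 4 * k t = Num.sqrt 2 ^+ 2 * Z * Num.sqrt t%:R / Num.sqrt 2.
      by rewrite c2 /k; field; rewrite gt_eqF.
    by field; rewrite gt_eqF.
  by apply: le_trans H; rewrite lerDl mulr_ge0.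
elim: t => [|t IH]; first by
  rewrite big_ord0 /k sqrtr0 !mulr0 !mul0r !mulr0 addr0.
rewrite big_ord_recr /=.
have T0 : 0 < Num.sqrt (t.+1%:R : R) by rewrite sqrtr_gt0 ltr0n.
have ka : k t.+1 * (2 * alpha t) = 1.
  by rewrite /k /alpha; field; rewrite !gt_eqF.
have st := ler_wpM2l (k_ge0 t.+1) (regret_step t v1).
have aZ : k t.+1 * (alpha t ^+ 2 * Z ^+ 2) =
    Num.sqrt 2 * Z * (2 * Num.sqrt t.+1%:R)^-1.
  by rewrite /k /alpha; field; rewrite !gt_eqF.
rewrite mulrA ka mul1r mulrDr aZ in st.
have cZ : 0 <= Num.sqrt 2 * Z by rewrite mulr_ge0 ?ltW.
have gap := ler_wpM2l cZ (sqrt_succB_ge R t).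
(* Raising the weight of [dist v t] from [k t] to [k t.+1] costs at most [4 * (k t.+1 - k t)]. *)
have kS : 0 <= k t.+1 - k t.
  rewrite subr_ge0 ler_pM2r ?invr_gt0 ?mulr_gt0// ler_pM2l//.
  by rewrite ler_wsqrtr ?ler_nat.
have := ler_wpM2l kS (dist_le4 t); lra.
Qed.

Lemma margin_gap v s :
  min_margin z v - min_margin z (avg_normalized r s) <=
  dotr (g s) (v - avg_normalized r s) + ln n.+1%:R * (beta r s)^-1.
Proof.
have b0 := beta_gt0 r s.
have h1 : min_margin z v <= dotr (g s) v by exact: dotr_softmin_row_ge.
(* The margin of a fixed row is linear, so Gibbs' inequality at [avg r s] can be divided by
   [beta r s]. *)
have [k kE] := min_margin_attained z (avg_normalized r s).
have h2 : dotr (g s) (avg_normalized r s) <=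
    dotr (row k z) (avg_normalized r s) + ln n.+1%:R * (beta r s)^-1.
  rewrite /g /avg_normalized; move: (avg r s) => a.
  rewrite !dotrZr (mulrC (ln _)) -mulrDr ler_pM2l ?invr_gt0//.
  by apply: le_trans (dotr_softmin_row_le _ _) _; rewrite lerD2r min_margin_le.
rewrite dotrBr kE; lra.
Qed.

Lemma beta_growth t :
  Num.sqrt 2 * (gamma2 z / Z) * Num.sqrt t%:R <= beta r t.
Proof.
have m0 : 0 < m%:R :> R by rewrite ltr0n features_gt0.
have Z0 := norm_features_gt0.
have c0 : 0 < Num.sqrt (2 : R) by rewrite sqrtr_gt0.
have [v v1 [gE _]] := gamma2_max z.
have {}v1 := dotr_ball (ltW m0) v1.
(* The right-hand side is at most [beta r t], because [v] and the normalized iterate lie in the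
   ball. *)
suff H : Num.sqrt 2 * (gamma2 z / Z) * Num.sqrt t%:R <= m%:R * dotr (avg r t) v.
  apply: le_trans H _; rewrite avgE dotrZl mulrCA -[leRHS]mulr1.
  rewrite ler_pM2l ?beta_gt0//; apply: dotr_le1 => //.
  exact: avg_normalized_ball.
elim: t => [|t IH].
  rewrite sqrtr0 mulr0 /avg r0 scaler0 /dotr big1 ?mulr0// => j _.
  by rewrite mxE mul0r.
have T0 : 0 < Num.sqrt (t.+1%:R : R) by rewrite sqrtr_gt0 ltr0n.
have S0 : 0 <= Num.sqrt (t%:R : R) by exact: sqrtr_ge0.
have TS : Num.sqrt (t.+1%:R : R) ^+ 2 = Num.sqrt (t%:R : R) ^+ 2 + 1.
  by rewrite !sqr_sqrtr ?ler0n// -natr1.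
have gv : gamma2 z <= dotr (g t) v by rewrite gE; exact: dotr_softmin_row_ge.
have inc : alpha t * gamma2 z <= beta r t * alpha t * dotr (g t) v.
  have a0 := ltW (alpha_gt0 t).
  by apply: ler_pM => //; [exact: ltW|rewrite ler_peMl// beta_ge1].
have -> : m%:R * dotr (avg r t.+1) v =
    m%:R * dotr (avg r t) v + beta r t * alpha t * dotr (g t) v.
  by rewrite avgS dotrDl dotrZl; field; rewrite gt_eqF.
apply: le_trans (lerD IH inc).
have -> : alpha t * gamma2 z =
    Num.sqrt 2 * (gamma2 z / Z) * (Num.sqrt t.+1%:R)^-1.
  by rewrite /alpha; field; rewrite !gt_eqF.
(* With [T] and [S] the roots of [t + 1] and [t], it remains that [T <= S + T^-1], that is,
   [S ^+ 2 + 1 <= S * T + 1]. *)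
rewrite -mulrDr ler_pM2l ?mulr_gt0 ?invr_gt0//.
rewrite -(ler_pM2r T0) mulrDl mulVf ?gt_eqF// -expr2 TS lerD2r expr2.
by rewrite ler_wpM2l// ler_wsqrtr ?ler_nat.
Qed.

(** The smallest deficit is at most the average one over [t] steps. As [1 <= t], the default value
    of the maximum is one of its terms. *)
Lemma max_margin_ge t : (1 <= t)%N ->
  gamma2 z - Z / Num.sqrt t%:R *
    (2 * Num.sqrt 2 + Num.sqrt 3 * ln n.+1%:R / gamma2 z) <=
  \big[Num.max/min_margin z (avg_normalized r 0)]_(s < t)
      min_margin z (avg_normalized r s).
Proof.
move=> t1; set M := \big[_/_]_(_ < _) _.
have m0 : 0 < m%:R :> R by rewrite ltr0n features_gt0.
have Z0 := norm_features_gt0.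
have S0 : 0 < Num.sqrt (t%:R : R) by rewrite sqrtr_gt0 ltr0n.
have St : Num.sqrt (t%:R : R) ^+ 2 = t%:R by rewrite sqr_sqrtr.
have [v v1 [gE _]] := gamma2_max z.
have {}v1 := dotr_ball (ltW m0) v1.
have gap (s : 'I_t) : gamma2 z - M <=
    dotr (g s) (v - avg_normalized r s) + ln n.+1%:R * (beta r s)^-1.
  apply: le_trans (margin_gap v s); rewrite gE lerD2l lerN2.
  exact: (le_bigmax _ (fun s : 'I_t => min_margin z (avg_normalized r s)) s).
have sinv : \sum_(s < t) (beta r s)^-1 <=
    Num.sqrt 3 * Num.sqrt t%:R / (gamma2 z / Z).
  apply: sum_inv_le_sqrt; [|exact: beta_ge1|exact: beta_growth].
  by rewrite divr_gt0//= ler_pdivrMr// mul1r gamma2_le_norm.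
have ln0 : 0 <= ln (n.+1%:R : R) by rewrite ln_ge0// ler1n.
have h : t%:R * (gamma2 z - M) <= \sum_(s < t)
    (dotr (g s) (v - avg_normalized r s) + ln n.+1%:R * (beta r s)^-1).
  rewrite mulr_natl -[X in _ *+ X](card_ord t) -sumr_const.
  by apply: ler_sum => s _; exact: gap.
rewrite big_split /= -mulr_sumr in h.
have {}h := le_trans h (lerD (regret_sum t v1) (ler_wpM2l ln0 sinv)).
have c : t%:R * (Z / Num.sqrt t%:R *
    (2 * Num.sqrt 2 + Num.sqrt 3 * ln n.+1%:R / gamma2 z)) =
    2 * Num.sqrt 2 * Z * Num.sqrt t%:R +
    ln n.+1%:R * (Num.sqrt 3 * Num.sqrt t%:R / (gamma2 z / Z)).
  by rewrite -{1}St; field; rewrite !gt_eqF.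
rewrite -c ler_pM2l ?ltr0n// in h; lra.
Qed.

End ascent.

Unset Implicit Arguments.

Theorem proposition7 (R : realType) (d n m : nat) (sigma : R -> R)
    (x : 'I_n.+1 -> 'rV[R]_d) (y : 'I_n.+1 -> R)
    (b : 'I_m -> R) (c : 'I_m -> 'rV[R]_d) (r : nat -> 'rV[R]_m) :
  (forall i, y i = -1 \/ y i = 1) ->
  let z := feature_mx sigma x y b c in
  0 < gamma2 z ->
  r 0%N = 0 ->
  (forall t : nat,
    r t.+1 = r t + (step_size z r t * m%:R) *: grad (smooth_margin z) (r t)) ->
  forall t : nat, (1 <= t)%N ->
  \big[Num.max/min_margin z (avg_normalized r 0)]_(s < t)
      min_margin z (avg_normalized r s)
    >= gamma2 z - `|z| / Num.sqrt t%:R *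
         (2 * Num.sqrt 2 + Num.sqrt 3 * ln n.+1%:R / gamma2 z).
Proof.
move=> _ z gamma_gt0 r0 rS t t1; exact: max_margin_ge gamma_gt0 r0 rS t t1.
Qed.
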